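(* Let $m, C \in \mathbb{N}$ be positive, let $H \in \mathbb{R}^{m\times m}$ be symmetric positive definite, $F \in \mathbb{R}^m$, $A \in \mathbb{R}^{m \times C}$ and $B \in \mathbb{R}^C$. Let $P = [p_1,\dots,p_C]^\top \in \{-1,+1\}^C$ be a configuration and let $S(P) = \mathrm{diag}(P) \in \mathbb{R}^{C\times C}$. Then the quadratic program $$\min_{u \in \mathbb{R}^m} \left\{ u^\top H u + F^\top u \right\} \quad \text{s.t.} \quad S(P) A^\top u \le S(P) B$$ is feasible if and only if the linear program $$d^\star = \max_{\lambda \in \Lambda_P} \left\{ -B^\top \lambda \right\},$$ admits a bounded maximum, i.e. $d^\star < \infty$, where $$\Lambda_P = \left\{ \lambda \in \mathrm{null}(A) \subset \mathbb{R}^C \;\middle|\; \lambda_j \in (-\infty, 0] \text{ if } p_j = -1, \ \ \lambda_j \in [0,+\infty) \text{ if } p_j = +1, \ \ j = 1,\dots,C \right\}.$$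
   Context: Vector inequalities are componentwise. $\mathrm{null}(A) = \{x \in \mathbb{R}^C : A x = 0\}$ is the null space of $A$. A configuration is a vector $P \in \{-1,+1\}^C$; $p_j = -1$ means that the $j$-th constraint of $A^\top u \le B$ is ''disregarded'', i.e. replaced by the constraint with opposite sign, and $p_j = +1$ means it is kept. $\mathrm{diag}(P)$ is the diagonal matrix whose diagonal entries are the elements of $P$. A quadratic program is called feasible if its constraint set is nonempty. The value $d^\star$ is understood as the supremum of $-B^\top\lambda$ over $\lambda\in\Lambda_P$, taken in $\mathbb{R}\cup\{+\infty\}$. *)

(* Defs.v *)
From HB Require Import structures.
From mathcomp Require Import all_boot all_order all_algebra.
From mathcomp Require Import all_classical all_reals.
From mathcomp Require Import ereal.
Set Implicit Arguments.
Unset Strict Implicit.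
Unset Printing Implicit Defensive.
Import Order.TTheory GRing.Theory Num.Theory.
Local Open Scope classical_set_scope.
Local Open Scope ring_scope.

(* Vectors are column vectors; a scalar such as u^T H u is the single entry,
   written [0 0], of a 1 x 1 matrix. *)

Definition posdefmx (R : realType) (n : nat) (H : 'M[R]_n) : Prop :=
  forall x : 'cV[R]_n, x != 0 -> 0 < (x^T *m H *m x) 0 0.

Definition lev (R : realType) (n : nat) (x y : 'cV[R]_n) : Prop :=
  forall i, x i 0 <= y i 0.

Definition nullspace (R : realType) (m n : nat) (A : 'M[R]_(m, n)) :
    set 'cV[R]_n :=
  [set x | A *m x = 0].

Record program (R : realType) (n : nat) := Program {
  objective : 'cV[R]_n -> R ;
  constraint_set : set 'cV[R]_n }.

Definition feasible (R : realType) (n : nat) (Q : program R n) : Prop :=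
  constraint_set Q !=set0.

(* The value of Q as a maximization problem, in the extended reals. *)
Definition max_value (R : realType) (n : nat) (Q : program R n) : \bar R :=
  ereal_sup [set (objective Q x)%:E | x in constraint_set Q].

Definition configuration (R : realType) (C : nat) (P : 'cV[R]_C) : Prop :=
  forall j, P j 0 = -1 \/ P j 0 = 1.

(* [diag_mx] expects a row vector. *)
Definition config_mx (R : realType) (C : nat) (P : 'cV[R]_C) : 'M[R]_C :=
  diag_mx P^T.

Definition config_qp (R : realType) (m C : nat) (H : 'M[R]_m) (F : 'cV[R]_m)
    (A : 'M[R]_(m, C)) (B P : 'cV[R]_C) : program R m :=
  {| objective := fun u => (u^T *m H *m u) 0 0 + (F^T *m u) 0 0 ;
     constraint_set :=
       [set u | lev (config_mx P *m A^T *m u) (config_mx P *m B)] |}.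

Definition dual_cone (R : realType) (m C : nat) (A : 'M[R]_(m, C))
    (P : 'cV[R]_C) : set 'cV[R]_C :=
  [set l | nullspace A l /\
     forall j, (P j 0 = -1 -> l j 0 <= 0) /\ (P j 0 = 1 -> 0 <= l j 0)].

Definition config_lp (R : realType) (m C : nat) (A : 'M[R]_(m, C))
    (B P : 'cV[R]_C) : program R C :=
  {| objective := fun l => - (B^T *m l) 0 0 ;
     constraint_set := dual_cone A P |}.

(* Main.v *)
(* Necessity is weak duality: for a feasible [u] and [l] in the dual cone,
   [B^T l >= u^T A l = 0].  Sufficiency is Gale's theorem of the alternative for
   [S(P) A^T u <= S(P) B], obtained by Fourier-Motzkin elimination: if the
   system is infeasible, its certificate [y >= 0] gives a ray [S(P) y] of the
   dual cone along which [- B^T l] tends to [+oo]. *)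
Require Import Defs.
From HB Require Import structures.
From mathcomp Require Import all_boot all_order all_algebra.
From mathcomp Require Import all_classical all_reals.
From mathcomp Require Import ereal.
From mathcomp Require Import lra.
Set Implicit Arguments.
Unset Strict Implicit.
Unset Printing Implicit Defensive.
Import Order.TTheory GRing.Theory Num.Theory.
Local Open Scope ring_scope.

(** The largest lower bound serves as [t], or the smallest upper bound if there are no lower ones;
    [0] is for the case without any bounds. This later supplies the value of an eliminated
    variable. *)
Lemma finite_separation (F : realFieldType) (I : finType) (Q P : pred I)
    (f g : I -> F) :
  (forall q p, Q q -> P p -> f q <= g p) ->
  exists t, (forall q, Q q -> f q <= t) /\ (forall p, P p -> t <= g p).
Proof.
move=> le_fg; case: (pickP Q) => [q0 Qq0|Q0].
  case: (arg_maxP f Qq0) => q Qq max_q; exists (f q).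
  by split=> [q' /max_q|p Pp] //; exact: le_fg.
case: (pickP P) => [p0 Pp0|P0].
  case: (arg_minP g Pp0) => p Pp min_p; exists (g p).
  by split=> [q|p' /min_p] //; rewrite Q0.
by exists 0; split=> i; rewrite ?Q0 ?P0.
Qed.

(* The nonnegative combination of the rows [p] and [q] of a system whose
   eliminated variable has coefficients [c]. *)
Definition elim_row (F : realFieldType) (k : nat) (c : 'cV[F]_k)
    (p q : 'I_k) : 'rV[F]_k :=
  if c p 0 == 0 then delta_mx 0 p
  else if (0 < c p 0) && (c q 0 < 0)
    then c p 0 *: delta_mx 0 q - c q 0 *: delta_mx 0 p
  else 0.

Lemma elim_row_ge0 (F : realFieldType) k (c : 'cV[F]_k) p q i :
  0 <= elim_row c p q 0 i.
Proof.
rewrite /elim_row; case: ifP => _; first by rewrite mxE ler0n.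
case: ifP => [/andP[cp cq]|_]; last by rewrite mxE.
rewrite !mxE -mulNr addr_ge0 // mulr_ge0 ?ler0n //; first exact: ltW.
by rewrite oppr_ge0 ltW.
Qed.

Lemma elim_row_mul (F : realFieldType) k (c : 'cV[F]_k) p q :
  elim_row c p q *m c = 0.
Proof.
apply/matrixP => i j; rewrite !ord1 {i j} /elim_row; case: ifP => [/eqP cp|_].
  by rewrite -rowE !mxE.
case: ifP => _; last by rewrite mul0mx.
by rewrite mulmxBl -!scalemxAl -!rowE !mxE mulrC subrr.
Qed.

(** Fourier-Motzkin in one variable: rows with [c q 0 < 0] bound [t] from below, rows with
    [0 < c p 0] from above, and the mixed rows say that each lower bound is at most each upper one.
    Rows with zero coefficient survive unchanged, through the pair [(i, i)]. *)
Lemma elim_row_solvable (F : realFieldType) k (c d : 'cV[F]_k) :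
  (forall p q, 0 <= (elim_row c p q *m d) 0 0) ->
  exists t, forall i, c i 0 * t <= d i 0.
Proof.
move=> d_ge0.
have [|t [lo up]] := @finite_separation F 'I_k (fun q => c q 0 < 0)
    (fun p => 0 < c p 0) (fun q => d q 0 / c q 0) (fun p => d p 0 / c p 0).
  move=> q p cq cp; have := d_ge0 p q.
  rewrite /elim_row gt_eqF // cp cq /= mulmxBl -!scalemxAl -!rowE !mxE => h.
  rewrite ler_ndivrMr // mulrAC ler_pdivrMr //; lra.
exists t => i; case: (ltgtP (c i 0) 0) => [ci|ci|ci].
- by rewrite mulrC -ler_ndivrMr // lo.
- by rewrite mulrC -ler_pdivlMr // up.
- by have := d_ge0 i i; rewrite /elim_row ci eqxx mul0r -rowE mxE.
Qed.

Lemma mulmx_ge0 (F : realFieldType) m n p (A : 'M[F]_(m, n))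
    (B : 'M[F]_(n, p)) :
  (forall i j, 0 <= A i j) -> (forall i j, 0 <= B i j) ->
  forall i j, 0 <= (A *m B) i j.
Proof. by move=> A0 B0 i j; rewrite mxE sumr_ge0 // => l _; rewrite mulr_ge0. Qed.

Theorem gale_alternative (F : realFieldType) (n k : nat) (M : 'M[F]_(k, n))
    (b : 'cV[F]_k) :
  (exists u : 'cV_n, forall i, (M *m u) i 0 <= b i 0) \/
  (exists y : 'rV_k,
    [/\ forall i j, 0 <= y i j, y *m M = 0 & (y *m b) 0 0 < 0]).
Proof.
elim: n => [|n IHn] in k M b *.
  (* Without variables the system reads [0 <= b], so a negative entry is its own certificate. *)
  case: (pickP (fun i => b i 0 < 0)) => [i bi|b_ge0].
    right; exists (delta_mx 0 i); split=> [j l||].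
    - by rewrite mxE ler0n.
    - by rewrite [M]thinmx0 mulmx0.
    - by rewrite -rowE mxE.
  by left; exists 0 => i; rewrite mulmx0 mxE leNgt b_ge0.
rewrite -[n.+1]/(1 + n)%N in M *.
pose c := lsubmx M; pose N := rsubmx M.
(* One row per pair of inequalities; [W] is nonnegative and annihilates the column [c] of the first
   variable. *)
pose W : 'M[F]_(#|{: 'I_k * 'I_k}|, k) :=
  \matrix_r elim_row c (enum_val r).1 (enum_val r).2.
have W_ge0 i j : 0 <= W i j by rewrite mxE elim_row_ge0.
have Wc : W *m c = 0.
  by apply/row_matrixP => r; rewrite row_mul rowK elim_row_mul row0.
have [[u Wu]|[y [y_ge0 yW yb]]] := IHn _ (W *m N) (W *m b).
  have [|t tP] := @elim_row_solvable F k c (b - N *m u).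
    (* The eliminated system at [u] says [0 <= W *m (b - N *m u)], which is the solvability
       condition for the first variable. *)
    move=> p q; have := Wu (enum_rank (p, q)).
    rewrite -subr_ge0 -mulmxA => h.
    have : 0 <= (W *m (b - N *m u)) (enum_rank (p, q)) 0.
      by rewrite mulmxBr mxE [X in _ + X]mxE.
    suff -> : elim_row c p q = row (enum_rank (p, q)) W.
      by rewrite -row_mul [X in _ -> 0 <= X]mxE.
    by rewrite rowK enum_rankK.
  left; exists (col_mx t%:M u) => i.
  rewrite -[M]hsubmxK mul_row_col mul_mx_scalar -/c -/N 2!mxE.
  by have := tP i; rewrite [X in _ <= X]mxE [X in _ + X]mxE lerBrDr mulrC.
(* A certificate of the eliminated system pulls back along [W]. *)
right; exists (y *m W); split; last by rewrite -mulmxA.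
  exact: mulmx_ge0.
by rewrite -[M]hsubmxK mul_mx_row -mulmxA Wc mulmx0 -mulmxA yW row_mx0.
Qed.

Lemma config_mx_sq (R : realType) C (P : 'cV[R]_C) :
  configuration P -> config_mx P *m config_mx P = 1%:M.
Proof.
move=> P_config; rewrite /config_mx mulmx_diag -diag_const_mx.
congr diag_mx; apply/rowP => j; rewrite !mxE.
by case: (P_config j) => ->; rewrite ?mulrNN mulr1.
Qed.

Lemma config_mx_mul (R : realType) C (P l : 'cV[R]_C) j :
  (config_mx P *m l) j 0 = P j 0 * l j 0.
Proof. by rewrite /config_mx mul_diag_mx !mxE. Qed.

Lemma dual_coneP (R : realType) m C (A : 'M[R]_(m, C)) (P l : 'cV[R]_C) :
  configuration P ->
  dual_cone A P l <->
  A *m l = 0 /\ (forall j, 0 <= (config_mx P *m l) j 0).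
Proof.
move=> P_config; split=> -[Al l_ge0]; split=> // j; have := l_ge0 j;
  rewrite config_mx_mul; case: (P_config j) => ->.
- by case=> /(_ erefl); rewrite mulN1r oppr_ge0.
- by case=> _ /(_ erefl); rewrite mul1r.
(* The clause for the opposite sign is vacuous, since [-1] and [1] differ. *)
- by rewrite mulN1r oppr_ge0; split=> // /eqP; rewrite -subr_eq0; lra.
- by rewrite mul1r; split=> // /eqP; rewrite -subr_eq0; lra.
Qed.

(** With [S = config_mx P], the slack [S (B - A^T u)] and the multiplier [S l] are both nonnegative;
    as [S^2 = 1] and [A l = 0], their inner product is [B^T l]. *)
Lemma weak_duality (R : realType) m C (H : 'M[R]_m) (F u : 'cV[R]_m)
    (A : 'M[R]_(m, C)) (B P l : 'cV[R]_C) :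
  configuration P -> constraint_set (config_qp H F A B P) u ->
  dual_cone A P l -> 0 <= (B^T *m l) 0 0.
Proof.
move=> P_config uP /(dual_coneP _ _ P_config)[Al y_ge0].
set S := config_mx P in uP y_ge0; have SS := config_mx_sq P_config.
have trS : S^T = S by rewrite tr_diag_mx.
have <- : ((S *m B - S *m A^T *m u)^T *m (S *m l)) = B^T *m l.
  rewrite linearB /= !trmx_mul trmxK trS mulmxBl -!mulmxA.
  by rewrite ![S *m (S *m _)]mulmxA SS !mul1mx Al mulmx0 subr0.
apply: mulmx_ge0 => i j; last by rewrite ord1 y_ge0.
by rewrite 2!mxE [X in _ + X]mxE ord1 subr_ge0 uP.
Qed.

Lemma max_value_ray (R : realType) m C (A : 'M[R]_(m, C)) (B P l : 'cV[R]_C) :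
  configuration P -> dual_cone A P l -> (B^T *m l) 0 0 < 0 ->
  max_value (config_lp A B P) = +oo%E.
Proof.
move=> P_config /(dual_coneP _ _ P_config)[Al l_ge0] Bl.
have ray t : 0 <= t ->
    ((t * - (B^T *m l) 0 0)%:E <= max_value (config_lp A B P))%E.
  move=> t_ge0; apply: ereal_sup_ubound; exists (t *: l).
    apply/(dual_coneP _ _ P_config); split; first by rewrite -scalemxAr Al scaler0.
    by move=> j; rewrite -scalemxAr mxE mulr_ge0.
  by rewrite /= -scalemxAr mxE mulrN.
case: (max_value _) ray => [r|//|] ray; last by have := ray 0 (lexx _).
have r_ge0 : 0 <= r by have := ray 0 (lexx _); rewrite mul0r lee_fin.
have c_gt0 : 0 < - (B^T *m l) 0 0 by rewrite oppr_gt0.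
(* At this multiple of [l] the objective equals [r + 1], above the supposed finite value [r]. *)
have t_ge0 : 0 <= (r + 1) / - (B^T *m l) 0 0.
  by rewrite divr_ge0 ?(ltW c_gt0) // addr_ge0.
have := ray _ t_ge0; rewrite divfK ?gt_eqF //.
by rewrite lee_fin gerDl ler10.
Qed.

Theorem theorem2 (R : realType) (m C : nat) (m_gt0 : (0 < m)%N)
  (C_gt0 : (0 < C)%N) (H : 'M[R]_m) (F : 'cV[R]_m) (A : 'M[R]_(m, C))
  (B : 'cV[R]_C) (P : 'cV[R]_C)
  (H_sym : H \is symmetricmx) (H_posdef : posdefmx H)
  (P_config : configuration P) :
  feasible (config_qp H F A B P) <->
  (max_value (config_lp A B P) < +oo)%E.
Proof.
split=> [[u uP]|].
  apply: (@le_lt_trans _ _ 0%E); last exact: ltry.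
  apply: ge_ereal_sup => _ [l lP <-].
  by rewrite lee_fin oppr_le0; exact: weak_duality uP lP.
have [[u uP] _|[y [y_ge0 yA yB]]] :=
    gale_alternative (config_mx P *m A^T) (config_mx P *m B).
  by exists u.
have trS : (config_mx P)^T = config_mx P by rewrite tr_diag_mx.
(* The assumed bound becomes [+oo < +oo]; it remains to check that the ray lies in the cone and has
   [B^T l < 0]. *)
rewrite (@max_value_ray _ _ _ _ _ _ (config_mx P *m y^T)) ?ltxx //.
  apply/(dual_coneP _ _ P_config); split.
    by apply: trmx_inj; rewrite !trmx_mul trmxK trS -mulmxA yA trmx0.
  by move=> j; rewrite mulmxA config_mx_sq // mul1mx mxE.
have -> : B^T *m (config_mx P *m y^T) = (y *m (config_mx P *m B))^T.
  by rewrite !trmx_mul trS mulmxA.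
by rewrite mxE.
Qed.
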